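(* Let $r>0$ and let $\mathcal{X}$ be a vector subspace of $\mathcal{F}(r,\mathbb{C})$. Suppose $\mathcal{X}$ also has a topology (not necessarily compatible with the linear structure on $\mathcal{X}$) such that: (i) for each $w\in\mathbb{C}$ with $|w|<r$, the point evaluation map $f\mapsto f(w)$ is continuous on $\mathcal{X}$; (ii) $\mathcal{X}$ contains all the polynomials and they are dense in $\mathcal{X}$. Let $F:\mathcal{X}\to\mathbb{C}$ be a continuous linear functional such that $F(1)=1$ and $F((z-\alpha)^n)\neq 0$ whenever $n\ge 1$ is an integer and $\alpha$ is a complex scalar with $|\alpha|\ge r$. Then there exists a complex scalar $w$ with $|w|<r$ such that $F(f)=f(w)$ for every $f\in\mathcal{X}$.
   Context: $\mathcal{F}(r,\mathbb{C})$ denotes the set of all complex-valued functions on the open disc $\{z\in\mathbb{C}:|z|<r\}$, a vector space over $\mathbb{C}$ under pointwise addition and scalar multiplication. Polynomials (with complex coefficients, in the variable $z$) are regarded as elements of $\mathcal{F}(r,\mathbb{C})$ by restriction to this disc. The topology on $\mathcal{X}$ is an arbitrary topology satisfying (i) and (ii); the vector space operations need not be continuous. *)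

(* Defs.v *)
From HB Require Import structures.
From mathcomp Require Import all_boot all_order all_algebra.
From mathcomp Require Import complex.
From mathcomp Require Import boolp classical_sets functions reals.
From mathcomp Require Import topology tvs normed_module.

Set Implicit Arguments.
Unset Strict Implicit.
Unset Printing Implicit Defensive.

Import Order.TTheory GRing.Theory Num.Theory.
Import numFieldNormedType.Exports.

Local Open Scope ring_scope.
Local Open Scope complex_scope.

(* The complex numbers are R[i] for R : realType. R[i] itself has no topology
   instance; R[i]^o carries the norm topology and the scaling by R[i]. *)

(* A type W with an injection \val : W -> V whose image is S, the vector space
   structure making \val linear, and an unrelated topology: nothing asks the
   topology to be compatible with + or *:, nor to be induced from V. *)
#[short(type="preTopologicalSubLmodType")]
HB.structure Definition PreTopologicalSubLmodule (K : numDomainType)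
    (V : lmodType K) (S : pred V) :=
  {W of @GRing.SubLmodule K V S W & PreTopologicalLmodule K W}.

Definition disc (R : realType) (r : R) := {z : R[i] | `|z| < r%:C}.

Definition disc_fun (R : realType) (r : R) := disc r -> R[i]^o.
HB.instance Definition _ (R : realType) (r : R) :=
  GRing.Lmodule.on (disc_fun r).

Definition poly_fun (R : realType) (r : R) (p : {poly R[i]}) : disc_fun r :=
  fun z => p.[\val z].
Arguments poly_fun {R} r p.

Definition poly_in (R : realType) (r : R) (S : pred (disc_fun r))
    (X : preTopologicalSubLmodType S) (polyS : forall p, S (poly_fun r p))
    (p : {poly R[i]}) : X :=
  Sub (poly_fun r p) (polyS p).
Arguments poly_in {R r S} X polyS p.

(* Main.v *)
Require Import Defs.
From HB Require Import structures.
From mathcomp Require Import all_boot all_order all_algebra.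
From mathcomp Require Import complex.
From mathcomp Require Import boolp classical_sets functions reals.
From mathcomp Require Import topology tvs normed_module.
From mathcomp Require Import pseudometric_normed_Zmodule.
From mathcomp Require Import ring zify.

(** Write [L] for [F] restricted to polynomials. The whole content is that
    [L 'X^k = L 'X ^+ k] for every [k]: then [L] is evaluation at [w = L 'X],
    the hypothesis for [n = 1] at [a = w] forces [`|w| < r], and [F] agrees with
    evaluation at [w] on all of [X], because both are continuous into a
    Hausdorff space and the polynomials are dense.

    For the moments, fix [n] and regard [L (('X - a) ^+ n)] as a polynomial in
    [a]. Up to sign it is monic of degree [n] with roots [z_1, ..., z_n], all of
    modulus less than [r], and expanding the binomial shows that the [k]-th
    elementary symmetric function of the roots is ['C(n, k) * L 'X^k]
    ([moment_estimate]). In particular the roots sum to [n * L 'X], so that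

      [(\sum z_i) ^+ k = n ^ k * (L 'X) ^+ k]  and
      [k`! * e_k(z) = n ^_ k * L 'X^k].

    The first quantity sums [z_(i_1) * ... * z_(i_k)] over all [k]-tuples of
    indices, the second over the tuples without repetition. Their difference,
    the defect, has [n ^ k - n ^_ k] terms, each of modulus at most [r ^+ k]
    ([norm_defect_le]). Since this number of tuples is [O(n ^ (k - 1))]
    ([ffact_gap]), dividing by [n ^ k] and letting [n] grow gives
    [(L 'X) ^+ k = L 'X^k] ([moments_of_nonvanishing]). *)

Set Implicit Arguments.
Unset Strict Implicit.
Unset Printing Implicit Defensive.

Import Order.TTheory GRing.Theory Num.Theory.
Import numFieldNormedType.Exports.

Local Open Scope classical_set_scope.
Local Open Scope ring_scope.
Local Open Scope complex_scope.

(** * Elementary symmetric functions of a sequence *)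

Definition elem_sym (A : comNzRingType) (k : nat) (s : seq A) : A :=
  (\prod_(z <- s) (1 + z *: 'X))`_k.

Lemma elem_sym0 (A : comNzRingType) (s : seq A) : elem_sym 0 s = 1.
Proof.
rewrite /elem_sym; elim: s => [|z s IHs]; first by rewrite big_nil coef1.
by rewrite big_cons mulrDl mul1r -scalerAl coefD coefZ coefXM mulr0 addr0.
Qed.

Lemma elem_sym_cons (A : comNzRingType) k (z : A) s :
  elem_sym k.+1 (z :: s) = elem_sym k.+1 s + z * elem_sym k s.
Proof.
by rewrite /elem_sym big_cons mulrDl mul1r -scalerAl coefD coefZ coefXM.
Qed.

Lemma elem_sym_gt_size (A : comNzRingType) k (s : seq A) :
  (size s < k)%N -> elem_sym k s = 0.
Proof.
elim: s k => [|z s IHs] [|k] //= lt_s_k.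
  by rewrite /elem_sym big_nil coef1.
by rewrite elem_sym_cons !IHs ?mulr0 ?addr0 // ltnW.
Qed.

Lemma elem_sym1 (A : comNzRingType) (s : seq A) :
  elem_sym 1 s = \sum_(z <- s) z.
Proof.
elim: s => [|z s IHs]; first by rewrite elem_sym_gt_size // big_nil.
by rewrite elem_sym_cons IHs elem_sym0 mulr1 big_cons addrC.
Qed.

Lemma elem_sym_nseq (A : comNzRingType) k n (r : A) :
  elem_sym k (nseq n r) = r ^+ k *+ 'C(n, k).
Proof.
elim: n k => [|n IHn] [|k]; rewrite ?elem_sym0 ?bin0 ?expr0 //.
  by rewrite elem_sym_gt_size.
by rewrite elem_sym_cons !IHn binS mulrnDr exprS mulrnAr.
Qed.

(** Vieta's formulas. Indexing by [j + k = size s] rather than by [size s - k]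
    keeps the induction free of truncated subtraction. *)
Lemma coef_prod_XsubC_elem_sym (A : comNzRingType) (s : seq A) j k :
  (j + k)%N = size s ->
  (\prod_(z <- s) ('X - z%:P))`_j = (-1) ^+ k * elem_sym k s.
Proof.
elim: s j k => [|z s IHs] j k.
  move=> /eqP; rewrite addn_eq0 => /andP[/eqP-> /eqP->].
  by rewrite big_nil elem_sym0 mulr1 coef1.
rewrite big_cons mulrBl coefB coefXM coefCM /=.
case: k => [|k]; rewrite ?addn0 ?addnS /=.
  move=> ->; rewrite /= (IHs _ 0) ?addn0 // nth_default.
    by rewrite mulr0 subr0 !elem_sym0.
  by rewrite size_prod_XsubC.
case=> jks; rewrite elem_sym_cons (IHs j k jks) exprS.
(* the constant coefficient has no contribution from ['X * _]; correspondingly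
   [k.+1] exceeds [size s] *)
case: j jks => [|j] jks /=.
  by rewrite (@elem_sym_gt_size _ k.+1) -?jks //; ring.
by rewrite (IHs j k.+1) ?exprS //; [ring | rewrite addnS -jks].
Qed.

(** * Products over index tuples with a repetition *)

(** Equals the sum of [z_(i_1) * ... * z_(i_k)] over the [k]-tuples of indices
    that are not injective: a polynomial in the entries of [s] with nonnegative
    coefficients. *)
Definition defect (A : comNzRingType) (k : nat) (s : seq A) : A :=
  (\sum_(z <- s) z) ^+ k - elem_sym k s *+ k`!.

Lemma defect0 (A : comNzRingType) (s : seq A) : defect 0 s = 0.
Proof. by rewrite /defect elem_sym0 expr0 subrr. Qed.

Lemma defect_nil (A : comNzRingType) k : defect k ([::] : seq A) = 0.
Proof.
case: k => [|k]; first exact: defect0.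
by rewrite /defect big_nil expr0n elem_sym_gt_size // mul0rn subrr.
Qed.

(** Sorts the non-injective tuples by how often the index of [z] occurs: never,
    exactly once (in one of [k.+1] places), or at least twice, in which case the
    other indices are arbitrary. No subtraction occurs on the right, which is
    what makes the comparison in [norm_defect_le] possible. *)
Lemma defect_cons (A : comNzRingType) k (z : A) s :
  defect k.+1 (z :: s) =
    defect k.+1 s + z * defect k s *+ k.+1 +
    \sum_(i < k) (\sum_(y <- s) y) ^+ (k - i.+1) * z ^+ i.+2 *+ 'C(k.+1, i.+2).
Proof.
rewrite /defect elem_sym_cons big_cons factS; set S := \sum_(_ <- _) _.
rewrite [z + S]addrC exprDn !big_ord_recl /= bin0 bin1 expr0 mulr1 mulr1n subn0.
rewrite expr1 subSS subn0.
set T := \sum_(_ < _) _; move: T (k`!) => T f.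
have -> : (elem_sym k.+1 s + z * elem_sym k s) *+ (k.+1 * f) =
  elem_sym k.+1 s *+ (k.+1 * f) + z * (elem_sym k s *+ f) *+ k.+1.
  by rewrite mulrnDl mulnC !mulrnA mulrnAr.
ring.
Qed.

Lemma defect_nseq (A : comNzRingType) k n (r : A) :
  defect k (nseq n r) = r ^+ k * (n%:R ^+ k - (n ^_ k)%:R).
Proof.
rewrite /defect elem_sym_nseq big_nseq iter_addr_0 -mulrnA bin_ffact.
by rewrite -[r *+ n]mulr_natr exprMn -[r ^+ k *+ _]mulr_natr mulrBr.
Qed.

(** A polynomial with nonnegative coefficients grows in modulus when its
    arguments are replaced by an upper bound of their moduli; here positivity is
    read off the recursion [defect_cons]. *)
Lemma norm_defect_le (C : numDomainType) (r : C) k (s : seq C) :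
  {in s, forall z, `|z| <= r} -> `|defect k s| <= defect k (nseq (size s) r).
Proof.
elim: s k => [|z s IHs] k s_le; first by rewrite defect_nil normr0.
have z_le : `|z| <= r by apply: s_le; rewrite mem_head.
have {}s_le : {in s, forall y, `|y| <= r}.
  by move=> y ys; apply: s_le; rewrite inE ys orbT.
have sum_le : `|\sum_(y <- s) y| <= \sum_(y <- nseq (size s) r) y.
  have -> : \sum_(y <- nseq (size s) r) y = \sum_(y <- s) r.
    by rewrite big_nseq big_const_seq count_predT.
  apply: le_trans (ler_norm_sum _ _ _) _.
  by rewrite big_seq [leRHS]big_seq; apply: ler_sum => y; apply: s_le.
case: k => [|k]; first by rewrite !defect0 normr0.
rewrite /= !defect_cons; apply: (le_trans (ler_normD _ _)); apply: lerD.
  apply: (le_trans (ler_normD _ _)); apply: lerD; first exact: IHs.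
  rewrite normrMn normrM lerMn2r /=; apply: ler_pM => //; exact: IHs.
apply: (le_trans (ler_norm_sum _ _ _)); apply: ler_sum => i _.
rewrite normrMn normrM !normrX lerMn2r; apply/orP; right.
have sum_ge0 := le_trans (normr_ge0 _) sum_le.
have r_ge0 := le_trans (normr_ge0 _) z_le.
by apply: ler_pM; rewrite ?exprn_ge0 // lerXn2r ?nnegrE.
Qed.

Lemma leq_ffact_exp (n k : nat) : (n ^_ k <= n ^ k)%N.
Proof.
elim: k => // k IHk.
by rewrite ffactnSr expnSr leq_mul // leq_subr.
Qed.

(** Non-injective [k]-tuples are a fraction [O(1 / n)] of all [k]-tuples. The
    constant [k ^ 2] is cruder than the binomial ['C(k, 2)] of the union bound
    over pairs of equal entries, but closes the induction on [k] directly. *)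
Lemma ffact_gap (n k : nat) : (n * (n ^ k - n ^_ k) <= k ^ 2 * n ^ k)%N.
Proof.
elim: k => [|k IHk]; first by rewrite subnn muln0.
have le_ffact := leq_ffact_exp n k.
rewrite ffactnSr expnS; move: (n ^_ k) (n ^ k)%N IHk le_ffact => f p IHk le_fp.
have step : (n * p - f * (n - k) <= n * (p - f) + k * p)%N by nia.
apply: leq_trans (leq_mul (leqnn n) step) _.
nia.
Qed.

(** * Moments of a functional that does not vanish on powers *)

(** Written out by coefficients so that its degree and roots are accessible; as
    a function of [a] it is [L ((a - 'X) ^+ n)]. The order [a - 'X] makes it
    monic when [L 1 = 1]. *)
Definition translate_poly (C : comNzRingType) (L : {poly C} -> C) n :
    {poly C} :=
  \poly_(j < n.+1) ((-1) ^+ (n - j) * L 'X^(n - j) *+ 'C(n, j)).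

Lemma horner_translate_poly (C : comNzRingType) (L : {linear {poly C} -> C^o})
    n (a : C) :
  (translate_poly L n).[a] = (-1) ^+ n * L (('X - a%:P) ^+ n).
Proof.
have -> : ('X - a%:P) ^+ n =
    \sum_(j < n.+1) ((-1) ^+ j * a ^+ j *+ 'C(n, j)) *: 'X^(n - j).
  rewrite exprDn; apply: eq_bigr => j _.
  rewrite [(- a%:P) ^+ j]exprNn mulrC -mul_polyC polyCMn polyCM !polyC_exp.
  by rewrite polyCN mulrnAl.
rewrite horner_poly raddf_sum mulr_sumr; apply: eq_bigr => j _ /=.
have jn : (j <= n)%N by rewrite -ltnS.
have sgn : (-1) ^+ n * (-1) ^+ j = (-1) ^+ (n - j) :> C.
  by rewrite -exprD -[in LHS]signr_odd -[in RHS]signr_odd oddB // oddD.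
by rewrite linearZ /= -[_ *: _]/(_ * _) -sgn; ring.
Qed.

Lemma translate_poly_factor (C : numClosedFieldType)
    (L : {linear {poly C} -> C^o}) n :
  L 1 = 1 -> exists2 s : seq C, size s = n &
  translate_poly L n = \prod_(z <- s) ('X - z%:P).
Proof.
move=> L1; have lead1 : (-1) ^+ (n - n) * L 'X^(n - n) *+ 'C(n, n) = 1.
  by rewrite subnn expr0 mul1r binn L1.
have [s def_p] := closed_field_poly_normal (translate_poly L n).
rewrite lead_coef_poly // lead1 ?oner_neq0 // scale1r in def_p.
exists s => //; apply: succn_inj.
by rewrite -(size_prod_XsubC s id) -def_p size_poly_eq //= lead1 oner_neq0.
Qed.

Lemma coef_translate_poly (C : comNzRingType) (L : {poly C} -> C) n k :
  (k <= n)%N ->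
  (translate_poly L n)`_(n - k) = (-1) ^+ k * (L 'X^k *+ 'C(n, k)).
Proof.
by move=> kn; rewrite coef_poly ltnS leq_subr subKn // bin_sub // mulrnAr.
Qed.

(** [norm_defect_le] applied to the roots of [translate_poly L n], whose
    elementary symmetric functions are known. *)
Lemma moment_estimate (C : numClosedFieldType) (r : C)
    (L : {linear {poly C} -> C^o}) n k :
  r \is Num.real -> L 1 = 1 ->
  (forall a, r <= `|a| -> L (('X - a%:P) ^+ n) != 0) ->
  `|(L 'X *+ n) ^+ k - L 'X^k *+ n ^_ k| <= r ^+ k * (n%:R ^+ k - (n ^_ k)%:R).
Proof.
move=> r_real L1 L_neq0.
have [s size_s def_p] := translate_poly_factor n L1.
have s_le : {in s, forall z, `|z| <= r}.
  move=> z zs; apply: ltW; rewrite real_ltNge ?normr_real //.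
  apply/negP => /L_neq0/negP; apply.
  have : root (translate_poly L n) z by rewrite def_p root_prod_XsubC.
  by rewrite rootE horner_translate_poly mulf_eq0 signr_eq0.
have elem_sym_s j : elem_sym j s = L 'X^j *+ 'C(n, j).
  case: (leqP j n) => [jn | nj]; last first.
    by rewrite elem_sym_gt_size ?size_s // bin_small.
  apply: (can_inj (signrMK j)).
  rewrite -coef_translate_poly // def_p (@coef_prod_XsubC_elem_sym _ _ _ j) //.
  by rewrite subnK.
have sum_s : \sum_(z <- s) z = L 'X *+ n.
  by rewrite -elem_sym1 elem_sym_s bin1.
have := norm_defect_le k s_le.
by rewrite defect_nseq size_s /defect sum_s elem_sym_s -mulrnA bin_ffact.
Qed.

(** The Archimedean property, for the modulus of a complex number; the order of
    [R[i]] is only partial, so the comparison is made on real parts. *)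
Lemma eq0_of_natmul_bounded (R : realType) (x B : R[i]) :
  (forall n, (0 < n)%N -> n%:R * `|x| <= B) -> x = 0.
Proof.
move=> x_le; pose y : R := complex.Re `|x|.
have xE : `|x| = y%:C by rewrite RRe_real ?normr_real.
have y_le n : (0 < n)%N -> y *+ n <= complex.Re B.
  move=> /x_le; rewrite mulr_natl lecE => /andP[_].
  by rewrite raddfMn.
apply/eqP; rewrite -normr_le0 xE lecR leNgt; apply/negP => y_gt0.
have := y_le (Num.Def.archi_bound (complex.Re B / y)).+1 isT.
apply/negP; rewrite -ltNge -mulr_natl -ltr_pdivrMr //.
by apply: lt_trans (unstable.ltr_bound _) _; rewrite ltr_nat.
Qed.

(** The estimate for [n] says that [n ^ k * (L 'X) ^+ k] and [n ^_ k * L 'X^k]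
    differ by [O(n ^ (k - 1))]. Replacing [n ^_ k] by [n ^ k] costs no more, so
    [n * `|(L 'X) ^+ k - L 'X^k|] stays bounded as [n] grows. *)
Lemma moments_of_nonvanishing (R : realType) (r : R)
    (L : {linear {poly R[i]} -> R[i]^o}) :
  0 < r -> L 1 = 1 ->
  (forall n a, (1 <= n)%N -> r%:C <= `|a| -> L (('X - a%:P) ^+ n) != 0) ->
  forall k, L 'X^k = L 'X ^+ k.
Proof.
move=> r_gt0 L1 L_neq0 k; apply/esym/eqP; rewrite -subr_eq0; apply/eqP.
have r_ge0 : 0 <= r%:C by rewrite ler0c ltW.
apply: (@eq0_of_natmul_bounded _ _
  ((k ^ 2)%:R * (r%:C ^+ k + `|L 'X^k|))) => n n_gt0.
have npos : 0 < n%:R ^+ k :> R[i] by rewrite exprn_gt0 // ltr0n.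
have r_real : r%:C \is Num.real by apply: ger0_real.
have est := @moment_estimate _ _ L n k r_real L1 (fun a => L_neq0 n a n_gt0).
have le_ffact : (n ^_ k <= n ^ k)%N by exact: leq_ffact_exp.
have gapE : n%:R ^+ k - (n ^_ k)%:R = (n ^ k - n ^_ k)%:R :> R[i].
  by rewrite natrB // natrX.
rewrite gapE in est.
have diff_le : n%:R ^+ k * `|L 'X ^+ k - L 'X^k| <=
    (n ^ k - n ^_ k)%:R * (r%:C ^+ k + `|L 'X^k|).
  rewrite -[X in X * `|_|](ger0_norm (ltW npos)) -normrM.
  have -> : n%:R ^+ k * (L 'X ^+ k - L 'X^k) =
      ((L 'X *+ n) ^+ k - L 'X^k *+ n ^_ k) - (n ^ k - n ^_ k)%:R * L 'X^k.
    rewrite -gapE -[L (polyX _) *+ n]mulr_natl exprMn.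
    by rewrite -[L (polyX _ ^+ k) *+ _]mulr_natl; ring.
  apply: le_trans (ler_normB _ _) _; rewrite mulrDr normrM normr_nat lerD2r.
  by rewrite mulrC.
rewrite -(ler_pM2l npos) mulrCA.
apply: le_trans (ler_wpM2l (ler0n _ n) diff_le) _.
rewrite !mulrA ler_wpM2r ?addr_ge0 ?exprn_ge0 // -natrX -!natrM ler_nat.
by rewrite [X in (_ <= X)%N]mulnC ffact_gap.
Qed.

Lemma linear_poly_eval (C : comNzRingType) (L : {linear {poly C} -> C^o}) :
  (forall k, L 'X^k = L 'X ^+ k) -> forall p, L p = p.[L 'X].
Proof.
move=> LX p; rewrite -[in LHS](coefK p) poly_def raddf_sum horner_coef.
by apply: eq_bigr => i _ /=; rewrite linearZ /= LX.
Qed.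

(** * From polynomials to the whole space *)

Lemma dense_continuous_eq (T : topologicalType) (U : topologicalType)
    (D : set T) (f g : T -> U) :
  hausdorff_space U -> continuous f -> continuous g -> dense D ->
  {in D, f =1 g} -> f =1 g.
Proof.
rewrite open_hausdorff => U_sep f_cont g_cont D_dense eq_fg x.
apply/eqP; apply: contrapT => /negP/U_sep[[A B] /= [fxA gxB] [oA oB AB0]].
have [|| y [[/= fyA gyB] Dy]] := D_dense (f @^-1` A `&` g @^-1` B).
- by exists x; split; apply: set_mem.
- apply: openI; first by move/continuousP: f_cont; apply.
  by move/continuousP: g_cont; apply.
suff : (A `&` B) (f y) by rewrite (eqP AB0).
by split=> //; rewrite eq_fg ?inE.
Qed.

Lemma poly_in_is_linear (R : realType) (r : R) (S : pred (disc_fun r))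
    (X : preTopologicalSubLmodType S) (polyS : forall p, S (poly_fun r p)) :
  linear (poly_in X polyS).
Proof.
have valE p : \val (poly_in X polyS p) = poly_fun r p by exact: SubK.
move=> c p q; apply: val_inj; rewrite linearP /= !valE.
apply/funext => z; rewrite -[RHS]/(c * p.[\val z] + q.[\val z]).
by rewrite /poly_fun hornerD hornerZ.
Qed.

HB.instance Definition _ (R : realType) (r : R) (S : pred (disc_fun r))
    (X : preTopologicalSubLmodType S) (polyS : forall p, S (poly_fun r p)) :=
  GRing.isLinear.Build R[i] {poly R[i]} X *:%R (poly_in X polyS)
    (poly_in_is_linear X polyS).

Theorem theoremB (R : realType) (r : R) (r_gt0 : 0 < r)
    (S : pred (disc_fun r)) (X : preTopologicalSubLmodType S)
    (eval_cont : forall w : disc r, continuous (fun f : X => \val f w))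
    (polyS : forall p : {poly R[i]}, S (poly_fun r p))
    (poly_dense : dense (range (poly_in X polyS)))
    (F : {linear X -> R[i]^o}) (F_cont : continuous F)
    (F1 : F (poly_in X polyS 1) = 1)
    (F_neq0 : forall (n : nat) (a : R[i]), (1 <= n)%N -> r%:C <= `|a| ->
      F (poly_in X polyS (('X - a%:P) ^+ n)) <> 0) :
  exists w : disc r, forall f : X, F f = \val f w.
Proof.
pose L : {linear {poly R[i]} -> R[i]^o} := F \o poly_in X polyS.
have LE p : L p = F (poly_in X polyS p) by [].
have L1 : L 1 = 1 by exact: F1.
have L_neq0 n a : (1 <= n)%N -> r%:C <= `|a| -> L (('X - a%:P) ^+ n) != 0.
  by move=> n_gt0 le_ra; apply/eqP; exact: F_neq0.
have L_eval := linear_poly_eval (moments_of_nonvanishing r_gt0 L1 L_neq0).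
(* otherwise ['X - (L 'X)%:P] would be a forbidden zero of [L] *)
have w_lt : `|L 'X| < r%:C.
  rewrite real_ltNge ?normr_real ?ger0_real ?ler0c ?(ltW r_gt0) //.
  apply/negP => le_rw; have /negP := L_neq0 1%N (L 'X) isT le_rw; apply.
  by rewrite expr1 L_eval hornerXsubC subrr eqxx.
pose w : disc r := exist _ (L 'X : R[i]) w_lt; exists w.
apply: (dense_continuous_eq _ F_cont (eval_cont w) poly_dense).
  exact: norm_hausdorff.
move=> _ /set_mem[p _ <-]; rewrite -LE L_eval.
by rewrite SubK.
Qed.
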